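(* Let $F:[a,b]\times\mathbb R^d\to\mathbb R^d$ be such that for every $x\in\mathbb R^d$ the map $t\mapsto F(t,x)$ is $\mu_g$-measurable, and for $\mu_g$-a.e. $t$ the map $x\mapsto F(t,x)$ is continuous. Let $u_0\in\mathbb R^d$. Suppose, in addition, that there exist $R>0$ and a nonnegative function $h_R\in L_g^1([a,b))$ such that $$\|F(t,x)\|\le h_R(t)\quad\text{for }\mu_g\text{-a.e. }t\text{ and all }\|x\|\le R,\qquad\text{and}\qquad\|u_0\|+\|h_R\|_{L_g^1}\le R.$$ Then the integral equation $$U(t)=u_0+\int_{[a,t)}F(s,U(s))\,d\mu_g(s),\qquad t\in[a,b],$$ has at least one solution $U\in AC_g([a,b];\mathbb R^d)$ satisfying $\sup_{t\in[a,b]}\|U(t)\|\le R$. Consequently, there exists at least one global weak solution (with initial trace $u_0$).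
   Context: Let $\mathbb F$ be $\mathbb R$ or $\mathbb C$, let $a<b$ be real, $d\in\mathbb N$, and let $g:[a,b]\to\mathbb R$ be nondecreasing and left-continuous. $\mu_g$ is the finite Lebesgue--Stieltjes measure on $[a,b)$ with $\mu_g([s,t))=g(t)-g(s)$ for $a\le s\le t\le b$. Standing assumption: $M_g:=\mu_g([a,b))=g(b)-g(a)>0$. For $1\le p\le\infty$, $L_g^p([a,b))$ is the $L^p$ space of $\mathbb F$-valued functions for the completion of $\mu_g$ (modulo $\mu_g$-a.e. equality); measurability is with respect to this completion; vector-valued spaces and integrals are understood componentwise. $J_g:=\{t\in[a,b):\Delta g(t):=g(t^+)-g(t)>0\}$ is the set of jump points. $AC_g([a,b])$ is the set of $u:[a,b]\to\mathbb F$ such that for every $\varepsilon>0$ there is $\delta>0$ such that, for every finite family of pairwise disjoint intervals $[a_j,b_j)\subset[a,b)$, $\sum_j(g(b_j)-g(a_j))<\delta$ implies $\sum_j|u(b_j)-u(a_j)|<\varepsilon$. It is known that $u\in AC_g([a,b])$ if and only if there is $v\in L_g^1([a,b))$ with $u(t)=u(a)+\int_{[a,t)}v\,d\mu_g$ for all $t\in[a,b]$; $v$ is unique $\mu_g$-a.e. and the Stieltjes derivative is $D_gu:=v$. $AC_g([a,b];\mathbb R^d)$ is understood componentwise. Posterior trace: $S_g\varphi(t):=\varphi(t^+)$ if $t\in J_g$ and $S_g\varphi(t):=\varphi(t)$ otherwise. Test space: $\mathcal T_g$ is the set of $\varphi:[a,b]\to\mathbb F$ of the form $\varphi(t)=c+\int_{[a,t)}\psi\,d\mu_g$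 with $c\in\mathbb F$, $\psi\in L_g^\infty([a,b))$ (so $D_g\varphi=\psi$). Global weak solution with initial trace $u_0$: a state $([u],u_0,u_b)$ with $u\in L_g^1([a,b);\mathbb R^d)$, $u_b\in\mathbb R^d$, such that $F(\cdot,u(\cdot))\in L_g^1$ and, for every $\varphi\in\mathcal T_g$ (componentwise identity), $$\int_{[a,b)}u\,D_g\varphi\,d\mu_g+\int_{[a,b)}F(t,u(t))\,S_g\varphi(t)\,d\mu_g(t)=u_b\varphi(b)-u_0\varphi(a).$$ *)

(* Defs.v *)
From HB Require Import structures.
From mathcomp Require Import all_boot all_order all_algebra.
From mathcomp Require Import all_classical all_reals all_analysis.
From mathcomp.real_closed Require Import complex.
From mathcomp Require Import ring.

Set Implicit Arguments.
Unset Strict Implicit.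
Unset Printing Implicit Defensive.
Import Order.TTheory GRing.Theory Num.Theory.
Import numFieldNormedType.Exports.

Local Open Scope classical_set_scope.
Local Open Scope ring_scope.

(* Functions on [a, b] are total functions on R of which only the restriction
   to [a, b] (or [a, b[) is ever used. *)
Record derivator (R : realType) (a b : R) := Derivator {
  derivator_fun :> R -> R ;
  derivator_lt : a < b ;
  derivator_nondecreasing : {in `[a, b] &, nondecreasing_fun derivator_fun} ;
  derivator_left_continuous :
    forall t, a < t <= b -> derivator_fun s @[s --> t^'-] --> derivator_fun t
}.

Section measure.
Context (R : realType) (a b : R) (g : derivator a b).

Definition derivator_ext (t : R) : R := g (Num.max a (Num.min b t)).

(* The library builds Lebesgue-Stieltjes measures from right-continuous
   functions by mu ]s, t] = f t - f s.  Feeding it the right-continuous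
   modification t |-> g(t+) of g, extended by constants outside [a, b], gives
   the measure with mu [s, t[ = g t - g s: see stieltjes_itv below. *)
Definition derivator_rc (t : R) : R := lim (derivator_ext s @[s --> t^'+]).

Let clampP t : Num.max a (Num.min b t) \in `[a, b].
Proof.
rewrite in_itv/= le_max lexx/= ge_max (ltW (derivator_lt g))/=.
by rewrite ge_min lexx.
Qed.

Lemma derivator_ext_nd : nondecreasing_fun derivator_ext.
Proof.
move=> s t st; apply: derivator_nondecreasing; rewrite ?clampP//.
rewrite ge_max !le_max lexx/=; apply/orP; right.
by rewrite le_min !ge_min lexx/= st orbT.
Qed.

Lemma derivator_extE t : t \in `[a, b] -> derivator_ext t = g t.
Proof.
rewrite in_itv/= => /andP[at_ tb].
by rewrite /derivator_ext (min_idPr tb) (max_idPr at_).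
Qed.

Lemma derivator_rc_cvg t :
  derivator_ext s @[s --> t^'+] --> derivator_rc t.
Proof.
apply: nondecreasing_at_right_is_cvgr.
  by near=> x => u v _ _; exact: derivator_ext_nd.
near=> x; exists (derivator_ext t) => _ [u + <-].
by rewrite /= in_itv/= => /andP[/ltW tu _]; exact: derivator_ext_nd.
Unshelve. all: by end_near. Qed.

Lemma derivator_rc_ge t : derivator_ext t <= derivator_rc t.
Proof.
apply: limr_ge; first by apply/cvg_ex; exists (derivator_rc t); exact: derivator_rc_cvg.
by near=> s; apply: derivator_ext_nd; near: s; exact: nbhs_right_ge.
Unshelve. all: by end_near. Qed.

Lemma derivator_rc_le s t : s < t -> derivator_rc s <= derivator_ext t.
Proof.
move=> st; apply: limr_le; first by apply/cvg_ex; exists (derivator_rc s); exact: derivator_rc_cvg.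
by near=> u; apply: derivator_ext_nd; near: u; exact: nbhs_right_le.
Unshelve. all: by end_near. Qed.

Lemma derivator_rc_nd : nondecreasing derivator_rc.
Proof.
move=> s t; rewrite le_eqVlt => /predU1P[->//|st].
exact: le_trans (derivator_rc_le st) (derivator_rc_ge t).
Qed.

Lemma derivator_rc_right_continuous : right_continuous derivator_rc.
Proof.
move=> t; apply/cvgrPdist_le => e e0.
have /cvgrPdist_le/(_ _ e0)[d /= d0 H] := @derivator_rc_cvg t.
near=> s.
have ts : t < s by near: s; exact: nbhs_right_gt.
have st2 : s < t + d by near: s; apply: nbhs_right_lt; rewrite ltrDl.
set u := (s + (t + d)) / 2.
have su : s < u by rewrite /u midf_lt.
have ud : u < t + d by rewrite /u midf_lt.
have tu : t < u by apply: lt_trans su.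
have := H u; rewrite /ball_/= => /(_ _ tu); rewrite ltr0_norm ?subr_lt0//.
rewrite opprB ltrBlDl => /(_ ud).
rewrite ler0_norm ?subr_le0 ?derivator_rc_le// => Hu.
rewrite ler0_norm ?subr_le0 ?derivator_rc_nd ?(ltW ts)//.
apply: le_trans Hu.
by rewrite !opprB lerB// derivator_rc_le.
Unshelve. all: by end_near. Qed.

HB.instance Definition _ := isCumulative.Build R _ R derivator_rc
  derivator_rc_nd derivator_rc_right_continuous.

(* The completed measure; its measurable sets are the Caratheodory ones. *)
Definition stieltjes := completed_lebesgue_stieltjes_measure derivator_rc.

HB.instance Definition _ := Measure.on stieltjes.

Lemma derivator_ext_left_continuous t : t \in `[a, b] ->
  derivator_ext s @[s --> t^'-] --> derivator_ext t.
Proof.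
rewrite in_itv/= => /andP[]; rewrite le_eqVlt => /predU1P[<- _|at_ tb].
  have E s : s <= a -> derivator_ext s = g a.
    by move=> sa; rewrite /derivator_ext max_l// ge_min sa orbT.
  rewrite E//; apply: cvg_near_cst.
  by near=> s; apply/E/ltW; near: s; exact: nbhs_left_lt.
rewrite derivator_extE ?in_itv/= ?(ltW at_)//.
have := @derivator_left_continuous _ _ _ g t; rewrite at_ tb => /(_ erefl) gt.
apply/cvgrPdist_le => e e0; move/cvgrPdist_le: gt => /(_ _ e0) gt.
near=> s; rewrite derivator_extE; first by near: s; exact: gt.
rewrite in_itv/=; apply/andP; split.
  by near: s; exact: nbhs_left_ge.
by apply: le_trans tb; near: s; exact: nbhs_left_le.
Unshelve. all: by end_near. Qed.

Let stieltjes_oc s t : s <= t ->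
  stieltjes `]s, t] = (derivator_rc t - derivator_rc s)%:E.
Proof.
move=> st; rewrite /stieltjes /completed_lebesgue_stieltjes_measure.
rewrite /completed_measure_extension measurable_mu_extE/=; last exact: is_ocitv.
by rewrite wlength_itv_bnd.
Qed.

Let measurable_oc s t : measurable (`]s, t]%classic :
  set (caratheodory_type (wlength derivator_rc)^*%mu)).
Proof. by apply: caratheodory_measurable_mu_ext; exact: is_ocitv. Qed.

Let measurable_1 t : measurable ([set t] :
  set (caratheodory_type (wlength derivator_rc)^*%mu)).
Proof. by rewrite set1_bigcap_oc; exact: bigcap_measurable. Qed.

Let stieltjes_1 t : t \in `[a, b] ->
  stieltjes [set t] = (derivator_rc t - derivator_ext t)%:E.
Proof.
move=> tab; pose F n := `](t - n.+1%:R^-1), t]%classic.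
have FE n : stieltjes (F n) = (derivator_rc t - derivator_rc (t - n.+1%:R^-1))%:E.
  by rewrite stieltjes_oc// lerBlDr lerDl.
have cF : stieltjes \o F @ \oo --> stieltjes [set t].
  rewrite set1_bigcap_oc; apply: nonincreasing_cvg_mu => //.
  - by rewrite [X in (X < _)%E]FE ltry.
  - by move=> i; exact: measurable_oc.
  - by rewrite -set1_bigcap_oc.
  - move=> m n mn; apply/subsetPset => x; rewrite /F/= !in_itv/= => /andP[tx ->].
    rewrite andbT; apply: le_lt_trans tx.
    by rewrite lerB// lef_pV2 ?posrE// ler_nat.
apply: (cvg_unique _ cF) => //.
have -> : stieltjes \o F =
    EFin \o (fun n => derivator_rc t - derivator_rc (t - n.+1%:R^-1)).
  by apply/funext => n; rewrite /= FE.
apply: cvg_EFin; first by near=> n.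
apply: cvgB; first exact: cvg_cst.
have ct : derivator_ext (t - n.+1%:R^-1) @[n --> \oo] --> derivator_ext t.
  have /cvg_at_leftP := derivator_ext_left_continuous tab; apply; split.
    by move=> n; rewrite ltrBlDr ltrDl.
  rewrite -[X in _ --> X]subr0; apply: cvgB; first exact: cvg_cst.
  by rewrite -[X in X @ _ --> _]/(@harmonic R); exact: cvg_harmonic.
apply: (squeeze_cvgr _ ct (cvg_cst _)).
near=> n; rewrite derivator_rc_ge/= derivator_rc_le//.
by rewrite ltrBlDr ltrDl.
Unshelve. all: by end_near. Qed.

Lemma stieltjes_itv s t : a <= s -> s <= t -> t <= b ->
  stieltjes `[s, t[ = (g t - g s)%:E.
Proof.
move=> as_; rewrite le_eqVlt => /predU1P[<- _|st tb].
  by rewrite set_itvco0 measure0 subrr.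
have sI : s \in `[a, b] by rewrite in_itv/= as_ (le_trans (ltW st)).
have tI : t \in `[a, b] by rewrite in_itv/= tb (le_trans as_ (ltW st)).
have mco : measurable (`[s, t[%classic :
    set (caratheodory_type (wlength derivator_rc)^*%mu)).
  have -> : `[s, t[%classic = ([set s] `|` `]s, t]%classic) `\` [set t].
    by rewrite setU1itv ?bnd_simp ?ltW// setDitv1r.
  by apply: measurableD => //; exact: measurableU.
have e1 : stieltjes (`[s, t[%classic `|` [set t]) =
    (stieltjes `[s, t[ + stieltjes [set t])%E.
  apply: measureU => //; apply/seteqP; split=> // x [/=].
  by rewrite in_itv/= => /andP[_ xt] xE; rewrite xE ltxx in xt.
have e2 : stieltjes ([set s] `|` `]s, t]%classic) =
    (stieltjes [set s] + stieltjes `]s, t])%E.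
  apply: measureU => //; apply/seteqP; split=> // x [/= ->].
  by rewrite in_itv/= ltxx.
move: e1; rewrite setUitv1 ?bnd_simp ?ltW// -(setU1itv false) ?bnd_simp ?ltW//.
rewrite e2 !stieltjes_1// stieltjes_oc ?ltW// !derivator_extE// -EFinD.
move=> /(congr1 (fun x => x - (derivator_rc t - g t)%:E)%E).
rewrite addeK// => <-; rewrite -EFinB; congr EFin.
by ring.
Qed.

End measure.
Arguments stieltjes {R a b} g _.

Definition euclidean_norm (R : realType) (d : nat) (x : 'rV[R]_d) : R :=
  Num.sqrt (\sum_i x 0 i ^+ 2).

Section spaces.
Context (R : realType) (a b : R) (g : derivator a b).
Local Notation mu := (stieltjes g).

Definition stieltjes_measurable (f : R -> R) :=
  measurable_fun
    (`[a, b[%classic : set (caratheodory_type (wlength (derivator_rc g))^*%mu))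
    f.

Definition ae_on (P : R -> Prop) :=
  \forall t \ae mu, t \in `[a, b[ -> P t.

Definition stieltjes_L1 (f : R -> R) := mu.-integrable `[a, b[ (EFin \o f).

Definition stieltjes_L1norm (f : R -> R) : R :=
  \int[mu]_(t in `[a, b[) `|f t|.

Definition ACg (u : R -> R) :=
  forall e : R, 0 < e -> exists2 delta : R, 0 < delta &
    forall (n : nat) (s t : 'I_n -> R),
      (forall j, a <= s j /\ s j < t j /\ t j <= b) ->
      trivIset setT (fun j => `[s j, t j[%classic) ->
      \sum_j (g (t j) - g (s j)) < delta ->
      \sum_j `|u (t j) - u (s j)| < e.

Section vector.
Context (d : nat).

Definition stieltjes_measurable_vec (u : R -> 'rV[R]_d) :=
  forall i, stieltjes_measurable (fun t => u t 0 i).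

Definition stieltjes_L1_vec (u : R -> 'rV[R]_d) :=
  forall i, stieltjes_L1 (fun t => u t 0 i).

Definition ACg_vec (u : R -> 'rV[R]_d) := forall i, ACg (fun t => u t 0 i).

Definition integral_vec (A : set R) (u : R -> 'rV[R]_d) : 'rV[R]_d :=
  \row_i \int[mu]_(t in A) u t 0 i.

(* Integrability is required explicitly because the library's integral is
   total. *)
Definition integral_solution (F : R -> 'rV[R]_d -> 'rV[R]_d) (u0 : 'rV[R]_d)
    (U : R -> 'rV[R]_d) :=
  stieltjes_L1_vec (fun s => F s (U s)) /\
  (forall t, t \in `[a, b] -> U t = u0 + integral_vec `[a, t[ (fun s => F s (U s))).

End vector.
End spaces.

(* The scalar field of the test functions, as a subset of the complex numbers *)
Inductive scalar_field := RealScalars | ComplexScalars.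

Definition scalars (R : realType) (K : scalar_field) : set R[i] :=
  match K with
  | RealScalars => [set z | complex.Im z = 0]
  | ComplexScalars => setT
  end.

Section weak.
Context (R : realType) (a b : R) (g : derivator a b) (K : scalar_field).
Local Notation mu := (stieltjes g).
Local Open Scope complex_scope.

Definition integral_cplx (A : set R) (f : R -> R[i]) : R[i] :=
  (\int[mu]_(t in A) complex.Re (f t)) +i* (\int[mu]_(t in A) complex.Im (f t)).

Definition stieltjes_Linfty (psi : R -> R[i]) :=
  [/\ forall t, t \in `[a, b[ -> scalars K (psi t),
      stieltjes_measurable g (fun t => complex.Re (psi t)),
      stieltjes_measurable g (fun t => complex.Im (psi t)) &
      exists M : R, ae_on g (fun t => `|psi t| <= M%:C)].

(* phi belongs to the test space, with Stieltjes derivative psi *)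
Definition test_function (phi psi : R -> R[i]) :=
  stieltjes_Linfty psi /\
  exists2 c : R[i], scalars K c &
    forall t, t \in `[a, b] -> phi t = c + integral_cplx `[a, t[ psi.

Definition jump_points : set R :=
  [set t | a <= t < b /\ 0 < lim (g s @[s --> t^'+]) - g t].

Definition right_limit (phi : R -> R[i]) (t : R) : R[i] :=
  lim (complex.Re (phi s) @[s --> t^'+]) +i*
  lim (complex.Im (phi s) @[s --> t^'+]).

Definition posterior_trace (phi : R -> R[i]) (t : R) : R[i] :=
  if t \in jump_points then right_limit phi t else phi t.

Definition global_weak_solution (d : nat) (F : R -> 'rV[R]_d -> 'rV[R]_d)
    (u : R -> 'rV[R]_d) (u0 ub : 'rV[R]_d) :=
  [/\ stieltjes_L1_vec g u,
      stieltjes_L1_vec g (fun t => F t (u t)) &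
      forall phi psi, test_function phi psi -> forall i : 'I_d,
        integral_cplx `[a, b[ (fun t => (u t 0 i)%:C * psi t) +
        integral_cplx `[a, b[
          (fun t => (F t (u t) 0 i)%:C * posterior_trace phi t) =
        (ub 0 i)%:C * phi b - (u0 0 i)%:C * phi a].

End weak.

(* Main.v *)
(* Existence is Peano's theorem by Euler polygons.  Freezing the state on a mesh
   of step 1/(n+1) gives explicit functions U_n with values in the ball of radius
   r and |U_n(t) - U_n(s)| <= |H(t) - H(s)|, where H(t) is the integral of h_R
   over [a, t[.  The bounded function H makes this pseudometric totally bounded,
   so a subsequence of U_n converges everywhere, atoms included; since H is
   left-continuous, the frozen states converge to the same limit, and dominated
   convergence yields the integral equation.

   The weak formulation for u = U and u_b = U(b) is an integration by parts:
   the posterior trace of c + int_[a,t[ psi is c + int_[a,t] psi, so exchanging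
   the order of integration counts the diagonal exactly once. *)

Require Import Defs.
From mathcomp Require Import all_boot all_order all_algebra.
From mathcomp Require Import all_classical all_reals all_analysis.
From mathcomp.real_closed Require Import complex.
From mathcomp Require Import measurable_realfun lra ring.
Set Implicit Arguments.
Unset Strict Implicit.
Unset Printing Implicit Defensive.
Import Order.TTheory GRing.Theory Num.Theory.
Import numFieldNormedType.Exports.
Local Open Scope classical_set_scope.
Local Open Scope ring_scope.

(** * The Euclidean norm on row vectors: Cauchy-Schwarz, triangle inequality, limits *)

Section euclidean_norm.
Context (R : realType) (d : nat).
Implicit Types x y : 'rV[R]_d.

Lemma euclidean_norm_ge0 x : 0 <= euclidean_norm x.
Proof. exact: sqrtr_ge0. Qed.

Lemma euclidean_norm_sqr x : euclidean_norm x ^+ 2 = \sum_i x 0 i ^+ 2.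
Proof. by rewrite sqr_sqrtr// sumr_ge0// => i _; exact: sqr_ge0. Qed.

Lemma euclidean_norm0 : euclidean_norm (0 : 'rV[R]_d) = 0.
Proof.
rewrite /euclidean_norm big1 ?sqrtr0// => i _.
by rewrite mxE expr0n.
Qed.

Lemma le_coord_euclidean_norm x i : `|x 0 i| <= euclidean_norm x.
Proof.
rewrite -(@ler_pXn2r _ 2)// ?nnegrE ?euclidean_norm_ge0//.
rewrite euclidean_norm_sqr real_normK ?num_real// (bigD1 i)//= lerDl.
by rewrite sumr_ge0// => j _; exact: sqr_ge0.
Qed.

(* [0 <= | |x|^2 y - <x, y> x |^2 = |x|^2 (|x|^2 |y|^2 - <x, y>^2)] *)
Lemma euclidean_cauchy_schwarz x y :
  \sum_i x 0 i * y 0 i <= euclidean_norm x * euclidean_norm y.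
Proof.
set p := \sum_i _; have [p0|p0] := ltP p 0.
  by rewrite (le_trans (ltW p0))// mulr_ge0 ?euclidean_norm_ge0.
set nx := euclidean_norm x; set ny := euclidean_norm y.
rewrite -(@ler_pXn2r _ 2)// ?nnegrE ?mulr_ge0 ?euclidean_norm_ge0//.
rewrite exprMn.
have key : 0 <= nx ^+ 2 * (nx ^+ 2 * ny ^+ 2 - p ^+ 2).
  rewrite [X in 0 <= X](_ : _ = \sum_i (nx ^+ 2 * y 0 i - p * x 0 i) ^+ 2).
    by rewrite sumr_ge0// => i _; exact: sqr_ge0.
  transitivity (\sum_i (nx ^+ 4 * y 0 i ^+ 2 - (2 * nx ^+ 2 * p) * (x 0 i * y 0 i)
      + p ^+ 2 * x 0 i ^+ 2)).
    rewrite big_split/= sumrB -!mulr_sumr -/p -!euclidean_norm_sqr -/nx -/ny.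
    by ring.
  by apply: eq_bigr => i _; ring.
have [nx0|nx0] := eqVneq nx 0.
  have x0 i : x 0 i = 0.
    by apply/eqP; rewrite -normr_le0 -nx0 le_coord_euclidean_norm.
  rewrite [p]big1 => [|i _]; last by rewrite x0 mul0r.
  by rewrite expr0n nx0 expr0n mul0r.
by move: key; rewrite pmulr_rge0 ?subr_ge0// exprn_even_gt0//=.
Qed.

Lemma ler_euclidean_normD x y :
  euclidean_norm (x + y) <= euclidean_norm x + euclidean_norm y.
Proof.
rewrite -(@ler_pXn2r _ 2)// ?nnegrE ?addr_ge0 ?euclidean_norm_ge0//.
rewrite euclidean_norm_sqr.
rewrite (_ : \sum_i _ =
    euclidean_norm x ^+ 2 + (\sum_i x 0 i * y 0 i) *+ 2 + euclidean_norm y ^+ 2).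
  by rewrite sqrrD lerD2r lerD2l lerMn2r euclidean_cauchy_schwarz.
rewrite !euclidean_norm_sqr -sumrMnl -!big_split/=; apply: eq_bigr => i _.
by rewrite !mxE sqrrD.
Qed.

Lemma cvg_euclidean_norm (u : nat -> 'rV[R]_d) x :
  (forall i, u n 0 i @[n --> \oo] --> x 0 i) ->
  euclidean_norm (u n) @[n --> \oo] --> euclidean_norm x.
Proof.
move=> ux; apply: (@cvg_comp _ _ _ (fun n => \sum_i u n 0 i ^+ 2) (@Num.sqrt R)).
  apply: cvg_big => [|i _]; first exact: add_continuous.
  exact: (cvgM (ux i) (ux i)).
exact: sqrt_continuous.
Qed.

Lemma cvg_row (u : nat -> 'rV[R]_d) x :
  (forall i, u n 0 i @[n --> \oo] --> x 0 i) -> u n @[n --> \oo] --> x.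
Proof.
move=> ux; apply/cvg_ballP => e e0.
have : \forall n \near \oo, forall i, ball (x 0 i) e (u n 0 i).
  by apply: filter_forall => i; move/cvg_ballP: (ux i); exact.
by apply: filterS => n xu; split=> // j i; rewrite ord1; exact: xu.
Qed.

End euclidean_norm.

(** * Extraction of pointwise convergent subsequences *)

Section compactness.
Context (R : realType).

(** The image of [G] has a cluster point [c] in the compact segment. If the preimage of a
    neighbourhood of [c] is not in [G], its complement is, and this contradicts clustering; so [c]
    is a limit. *)
Lemma ultra_bounded_cvg (G : set_system nat) (u : nat -> R) (r : R) :
  UltraFilter G -> (forall n, `|u n| <= r) -> cvg (u @ G).
Proof.
move=> UG ur.
have cr : compact `[- r, r]%classic := @segment_compact _ _ _.
have GK : (u @ G) `[- r, r]%classic.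
  by apply: (@filterE _ G) => n; rewrite /= in_itv/= -ler_norml.
have [c [_ cc]] := cr _ (fmap_proper_filter u ultra_proper) GK.
apply/cvg_ex; exists c => V nV; rewrite /fmap/=.
have [//|GV] := in_ultra_setVsetC (u @^-1` V) UG.
by have [x []] := cc (~` V) V GV nV.
Qed.

(* An Arzela-Ascoli argument without diagonal extraction: limits are taken
   along a free ultrafilter, for which finite nets upgrade pointwise convergence
   to uniform convergence, and a sequence is only extracted at the end. *)
Lemma finite_nets_subsequence (X : Type) (w : nat -> X -> R) (r : R) :
  (forall n x, `|w n x| <= r) ->
  (forall e, 0 < e -> exists (J : finType) (p : J -> X),
     forall x, exists j, forall n, `|w n x - w n (p j)| <= e) ->
  exists (phi : nat -> nat) (W : X -> R),
    (forall n, (n <= phi n)%N) /\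
    (forall x, w (phi n) x @[n --> \oo] --> W x).
Proof.
move=> wr nets.
have [G [UG ooG]] := @ultraFilterLemma nat \oo _.
have PG : ProperFilter G := ultra_proper.
have wG x : cvg (w n x @[n --> G]) by exact: ultra_bounded_cvg.
pose W x : R := lim (w n x @[n --> G]).
have unif e : 0 < e -> \forall n \near G, forall x, `|w n x - W x| <= e.
  (* A net of mesh [e / 3], uniform in [n]: the distance from [w n x] to [W x] is split through a
     net point [p j], and only the finitely many net points need pointwise convergence. *)
  move=> e0; have [J [p pJ]] := nets _ (divr_gt0 e0 (ltr0Sn R 2)).
  have : \forall n \near G, forall j, `|W (p j) - w n (p j)| <= e / 3.
    by apply: filter_forall => j; move: (wG (p j)) => /cvgrPdist_le; apply; lra.
  apply: filterS => n Hn x; have [j xj] := pJ x.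
  have Wxj : `|W x - W (p j)| <= e / 3.
    have cW : `|w m x - w m (p j)| @[m --> G] --> `|W x - W (p j)|.
      by apply: cvg_norm; apply: cvgB; exact: wG.
    by rewrite -(cvg_lim (@Rhausdorff R) cW); apply: limr_le; [
      apply/cvg_ex; eexists; exact: cW | exact: filterE].
  rewrite (_ : w n x - W x =
    (w n x - w n (p j)) - (W (p j) - w n (p j)) - (W x - W (p j))); last by ring.
  rewrite (le_trans (ler_normB _ _))// (le_trans (lerD (ler_normB _ _) Wxj))//.
  by have := xj n; have := Hn j; lra.
(* Both conditions define sets of the proper filter [G], so some [n] satisfies them together.
   Monotonicity of [phi] is not claimed, only [k <= phi k]. *)
have /choice[phi phiP] : forall k, exists n, (k <= n)%N /\
    forall x, `|w n x - W x| <= k.+1%:R^-1.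
  move=> k; suff : \forall n \near G, (k <= n)%N /\
    forall x, `|w n x - W x| <= k.+1%:R^-1 by exact: filter_ex.
  apply: filterI; last by apply: unif; rewrite invr_gt0.
  by apply: ooG; exists k.
exists phi, W; split=> [n|x]; first by have [] := phiP n.
apply/cvgrPdist_le => e e0.
near=> n; have [_ /(_ x)] := phiP n; rewrite distrC => /le_trans; apply.
near: n; have /cvgrPdist_le/(_ _ e0) := @cvg_harmonic R.
by apply: filterS => n; rewrite sub0r normrN ger0_norm ?harmonic_ge0.
Unshelve. all: by end_near. Qed.

(* The sequence is 1-Lipschitz for the pseudometric [|H s - H t|], which is
   totally bounded because [H] is bounded. *)
Lemma equi_dominated_subsequence (I : finType) (w : nat -> R -> I -> R)
    (H : R -> R) (r M : R) :
  (forall n t i, `|w n t i| <= r) ->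
  (forall t, 0 <= H t <= M) ->
  (forall n s t i, `|w n t i - w n s i| <= `|H t - H s|) ->
  exists (phi : nat -> nat) (W : R -> I -> R),
    (forall n, (n <= phi n)%N) /\
    (forall t i, w (phi n) t i @[n --> \oo] --> W t i).
Proof.
move=> wr HM wH.
have nets e : 0 < e -> exists (J : finType) (p : J -> R * I),
    forall x, exists j, forall n,
      `|w n x.1 x.2 - w n (p j).1 (p j).2| <= e.
  (* Times are sorted by the value of [H] into finitely many cells of width [e]. The map [p] picks
     one time in each nonempty cell, with default 0 for an empty one. *)
  move=> e0; pose cell t := Num.truncn (H t / e).
  have cellM t : (cell t < (Num.truncn (M / e)).+1)%N.
    by rewrite ltnS le_truncn// ler_pM2r ?invr_gt0//; have /andP[] := HM t.
  have /choice[p pP] : forall j : 'I_(Num.truncn (M / e)).+1,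
      exists s, forall t, cell t = j -> cell s = j.
    move=> j; have [[s sj]|nj] := pselect (exists s, cell s = j).
      by exists s.
    by exists 0 => t tj; case: nj; exists t.
  exists ('I_(Num.truncn (M / e)).+1 * I)%type, (fun j => (p j.1, j.2)).
  move=> [t i]; exists (Ordinal (cellM t), i) => n /=.
  apply: le_trans (wH _ _ _ _) _.
  have := pP (Ordinal (cellM t)) t erefl => /= pt.
  have He s : 0 <= H s / e by rewrite divr_ge0 ?(ltW e0)//; have /andP[] := HM s.
  have := truncn_itv (He t); have := truncn_itv (He (p (Ordinal (cellM t)))).
  rewrite -!/(cell _) pt -!natr1 => /andP[l1 l2] /andP[l3 l4].
  rewrite -[leRHS]mul1r -ler_pdivrMr// -[X in _ / X](ger0_norm (ltW e0)).
  rewrite -normf_div ler_norml mulrBl.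
  by apply/andP; split; lra.
have [//|phi [W [phin WP]]] :=
  @finite_nets_subsequence (R * I) (fun n x => w n x.1 x.2) r _ nets.
by exists phi, (fun t i => W (t, i)); split=> // t i; exact: (WP (t, i)).
Qed.

End compactness.

(** * Real-valued and vector-valued integrals over a general measure space *)

Section Rintegral_lemmas.
Context d (T : measurableType d) (R : realType) (mu : {measure set T -> \bar R}).
Implicit Types (A B D : set T) (f h : T -> R).

Lemma integrable_bounded_by D f h : measurable D -> measurable_fun D f ->
  (forall x, D x -> `|f x| <= h x) ->
  mu.-integrable D (EFin \o h) -> mu.-integrable D (EFin \o f).
Proof.
move=> mD mf fh ih; apply: le_integrable ih => //; first exact/measurable_EFinP.
by move=> x Dx; rewrite /= lee_fin (le_trans (fh _ Dx))// ler_norm.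
Qed.

Lemma integrable_patch D f : measurable D ->
  mu.-integrable D (EFin \o f) -> mu.-integrable setT (EFin \o (f \_ D)).
Proof. by move=> mD /(integrable_mkcond _ mD); rewrite restrict_EFin. Qed.

Lemma dominated_cvg_Rintegral D (f_ : nat -> T -> R) f h : measurable D ->
  (forall n, measurable_fun D (f_ n)) ->
  (forall x, D x -> f_ n x @[n --> \oo] --> f x) ->
  mu.-integrable D (EFin \o h) ->
  (forall n x, D x -> `|f_ n x| <= h x) ->
  mu.-integrable D (EFin \o f) /\
  \int[mu]_(x in D) f_ n x @[n --> \oo] --> \int[mu]_(x in D) f x.
Proof.
move=> mD mf_ f_f ih fh.
have [||||intf _ cvgf] := @dominated_convergence _ _ _ mu D mD
    (fun n x => (f_ n x)%:E) (EFin \o f) (EFin \o h) _ _ _ ih.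
- by move=> n; exact/measurable_EFinP.
- by apply/measurable_EFinP; exact: measurable_fun_cvg f_f.
- by apply: aeW => x Dx; apply: cvg_EFin; [exact: nearW|exact: f_f].
- by apply: aeW => x n Dx; rewrite /= lee_fin fh.
split=> //; apply: fine_cvg; rewrite fineK//.
exact: integrable_fin_num.
Qed.

(** Dominated convergence with bound [|f|]: at each point the indicators of the sets [A_ n] are
    eventually constant. *)
Lemma cvg_Rintegral_set (A_ : nat -> set T) A f :
  (forall n, measurable (A_ n)) -> measurable A ->
  (forall x, \forall n \near \oo, (x \in A_ n) = (x \in A)) ->
  mu.-integrable setT (EFin \o f) ->
  \int[mu]_(x in A_ n) f x @[n --> \oo] --> \int[mu]_(x in A) f x.
Proof.
move=> mA_ mA A_A intf; rewrite Rintegral_mkcond.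
under eq_fun do rewrite Rintegral_mkcond.
have mf : measurable_fun setT f.
  by apply/measurable_EFinP; exact: measurable_int intf.
have [|||_ H] := @dominated_cvg_Rintegral setT (fun n => f \_ (A_ n)) (f \_ A)
  (Num.norm \o f) measurableT _ _ (integrable_norm intf) _.
- move=> n; apply/measurable_restrict => //.
  by rewrite setTI; exact: measurable_funS mf.
- move=> x _; apply: cvg_near_cst; apply: filterS (A_A x) => n.
  by rewrite /patch => ->.
- by move=> n x _ /=; rewrite /patch; case: ifPn => // _; rewrite normr0.
- exact: H.
Qed.

Lemma Rintegral_setB A B f : measurable A -> measurable B -> A `<=` B ->
  mu.-integrable setT (EFin \o f) ->
  \int[mu]_(x in B) f x - \int[mu]_(x in A) f x = \int[mu]_(x in B `\` A) f x.
Proof.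
move=> mA mB AB intf.
have mBA : measurable (B `\` A) by exact: measurableD.
have BE : A `|` (B `\` A) = B by exact: setDUK.
have <- : \int[mu]_(x in A `|` (B `\` A)) f x = \int[mu]_(x in B) f x by rewrite BE.
rewrite Rintegral_setU//; first by rewrite addrAC subrr add0r.
- by rewrite BE; apply: integrableS intf.
- by apply/disj_setPS => x [Ax []].
Qed.

(** Pair the integral [y] with itself: [|y|^2] is the integral of the inner products of [y] and
    [f x], which Cauchy-Schwarz bounds by [|y| * h x]. Dividing by [|y|] keeps the constant equal to
    1, as the sharp condition on [r] demands. *)
Lemma le_euclidean_norm_Rintegral m D (f : T -> 'rV[R]_m) h : measurable D ->
  (forall i, mu.-integrable D (EFin \o (fun x => f x 0 i))) ->
  mu.-integrable D (EFin \o h) ->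
  (forall x, D x -> euclidean_norm (f x) <= h x) ->
  euclidean_norm (\row_i \int[mu]_(x in D) f x 0 i) <= \int[mu]_(x in D) h x.
Proof.
move=> mD intf inth fh; set y := \row_i _.
have h0 : 0 <= \int[mu]_(x in D) h x.
  by apply: Rintegral_ge0 => x Dx; rewrite (le_trans _ (fh _ Dx))// euclidean_norm_ge0.
have intyf i : mu.-integrable D (EFin \o (fun x => y 0 i * f x 0 i)).
  by have := integrableZl mD (y 0 i) (intf i).
have intsum s : mu.-integrable D
    (EFin \o (fun x => \sum_(i <- s) y 0 i * f x 0 i)).
  have -> : EFin \o (fun x => \sum_(i <- s) y 0 i * f x 0 i) =
      (fun x => \sum_(i <- s) (y 0 i * f x 0 i)%:E)%E.
    by apply/funext => x; rewrite /= sumEFin.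
  by apply: integrable_sum => // i _; exact: intyf.
have sumE s : \sum_(i <- s) y 0 i * \int[mu]_(x in D) f x 0 i =
    \int[mu]_(x in D) (\sum_(i <- s) y 0 i * f x 0 i).
  elim: s => [|i s IH].
    rewrite big_nil; under eq_Rintegral do rewrite big_nil.
    by rewrite Rintegral_cst// mul0r.
  rewrite big_cons IH -RintegralZl// -RintegralD//.
  by apply: eq_Rintegral => x _; rewrite big_cons.
have [y0|y0] := eqVneq (euclidean_norm y) 0; first by rewrite y0.
rewrite -(@ler_pM2l _ (euclidean_norm y)) ?lt_neqAle 1?eq_sym ?y0 ?euclidean_norm_ge0//.
rewrite -expr2 euclidean_norm_sqr.
rewrite (eq_bigr (fun i => y 0 i * \int[mu]_(x in D) f x 0 i)); last first.
  by move=> i _; rewrite expr2 [X in _ * X]mxE.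
rewrite sumE -RintegralZl//; apply: le_Rintegral => //.
- by have := integrableZl mD (euclidean_norm y) inth.
- move=> x Dx; apply: (le_trans (euclidean_cauchy_schwarz y (f x))).
  by rewrite ler_wpM2l ?euclidean_norm_ge0 ?fh.
Qed.

(** Completeness of [mu] is what makes [k] measurable. All measurable subsets of [D] are covered
    because the integral equation involves every interval [[a, t[]. *)
Lemma integrable_ae_eq D f k : measure_is_complete mu -> measurable D ->
  (\forall x \ae mu, D x -> f x = k x) -> mu.-integrable D (EFin \o f) ->
  mu.-integrable D (EFin \o k) /\
  forall A, measurable A -> A `<=` D ->
    \int[mu]_(x in A) f x = \int[mu]_(x in A) k x.
Proof.
move=> cmu mD fk intf; have mf := measurable_int mu intf.
have fkE : ae_eq mu D (EFin \o f) (EFin \o k).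
  by apply: filterS fk => x /[apply] /= ->.
have mk := ae_measurable_fun cmu fkE mf.
split=> [|A mA AD].
  apply/integrableP; split=> //; case/integrableP: intf => _; apply: le_lt_trans.
  rewrite le_eqVlt; apply/orP; left; apply/eqP/ae_eq_integral => //;
    [exact: measurableT_comp|exact: measurableT_comp|].
  by apply: filterS fk => x /[apply] /= ->.
congr fine; apply: ae_eq_integral => //.
- exact: measurable_funS mf.
- exact: measurable_funS mk.
- exact: ae_eq_subset fkE.
Qed.

End Rintegral_lemmas.

(** * Measurable sets, null points and almost-everywhere statements for the Stieltjes measure *)

Section stieltjes_measure.
Context (R : realType) (a b : R) (g : derivator a b).
Local Notation T := (caratheodory_type (wlength (derivator_rc g))^*%mu).
Local Notation mu := (stieltjes g).

Lemma borel_stieltjes_measurable (A : set R) :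
  measurable A -> measurable (A : set T).
Proof. exact: sub_caratheodory. Qed.

Lemma measurable_stieltjes_itv (i : interval R) : measurable ([set` i] : set T).
Proof. by apply: borel_stieltjes_measurable; exact: measurable_itv. Qed.

Lemma measurable_stieltjes_id : measurable_fun setT (id : T -> R).
Proof. by move=> _ A mA; rewrite setTI; exact: borel_stieltjes_measurable. Qed.

Lemma stieltjes_complete : measure_is_complete (mu : set T -> \bar R).
Proof. exact: measure_is_complete_caratheodory. Qed.

(** The point lies in [[t, s[], of mass [g s - g t]; as [s] decreases to [t] this tends to the jump
    of [g] at [t], which is zero here. *)
Lemma stieltjes_set1_eq0 t : t \in `[a, b[ -> t \notin jump_points g ->
  mu [set t] = 0%E.
Proof.
rewrite in_itv/= => /andP[at_ tb] tJ.
have gt : g s @[s --> t^'+] --> derivator_rc g t.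
  apply: cvg_trans (derivator_rc_cvg (g := g) (t := t)).
  apply: near_eq_cvg; near=> s; rewrite derivator_extE// in_itv/=.
  by apply/andP; split; [apply: (le_trans at_)|]; near: s;
    [exact: nbhs_right_ge|exact: nbhs_right_le].
have gt0 : derivator_rc g t <= g t.
  rewrite leNgt; apply: contra tJ => tJ; rewrite inE; split; first exact/andP.
  by rewrite subr_gt0 (cvg_lim _ gt).
apply/eqP; rewrite -measure_le0.
apply/lee_addgt0Pr => e e0; rewrite add0e.
have /cvgrPdist_lt/(_ _ e0) ge := gt.
near (t^'+) => s.
have ts : t < s by near: s; exact: nbhs_right_gt.
have sb : s <= b by near: s; exact: nbhs_right_le.
have ges : `|derivator_rc g t - g s| < e by near: s.
rewrite (@le_trans _ _ (mu `[t, s[))//.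
  apply: le_measure; rewrite ?inE.
  - rewrite -[X in measurable X]set_itv1; exact: measurable_stieltjes_itv.
  - exact: measurable_stieltjes_itv.
  - by move=> _ ->; rewrite /= in_itv/= lexx.
rewrite stieltjes_itv ?(ltW ts)// lee_fin.
by move: ges gt0; rewrite ltr_norml => /andP[]; lra.
Unshelve. all: by end_near. Qed.

Lemma ae_onP (P : R -> Prop) : ae_on g P <-> exists N : set T,
  [/\ measurable N, mu N = 0%E & forall t, t \in `[a, b[ -> ~ N t -> P t].
Proof.
split=> [[N [mN N0 PN]]|[N [mN N0 PN]]]; exists N; split=> //.
  by move=> t tab Nt; apply: contrapT => Pt; apply/Nt/PN => /(_ tab).
by move=> t /= /not_implyP[tab Pt]; apply: contrapT => /(PN _ tab).
Qed.

Lemma ae_onS (P Q : R -> Prop) : (forall t, t \in `[a, b[ -> P t -> Q t) ->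
  ae_on g P -> ae_on g Q.
Proof.
move=> PQ /ae_onP[N [mN N0 PN]]; apply/ae_onP; exists N; split=> // t tab Nt.
by apply: PQ => //; exact: PN.
Qed.

End stieltjes_measure.

(** * Primitives over [[a, t[] and their increments *)

Section primitives.
Context (R : realType) (a b : R) (g : derivator a b) (d : nat).
Local Notation T := (caratheodory_type (wlength (derivator_rc g))^*%mu).
Local Notation mu := (stieltjes g).
Implicit Types f : R -> 'rV[R]_d.

Definition stieltjes_primitive (h : R -> R) (t : R) : R :=
  \int[mu]_(s in `[a, t[) h s.

Local Notation I := stieltjes_primitive.

Lemma stieltjes_primitive_le (h : R -> R) t : t <= a -> I h t = 0.
Proof. by move=> ta; rewrite /I set_itv_ge ?Rintegral_set0// bnd_simp -leNgt. Qed.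

Lemma stieltjes_primitiveB (h : R -> R) s t : s <= t ->
  mu.-integrable setT (EFin \o h) ->
  I h t - I h s = \int[mu]_(x in `[a, t[ `\` `[a, s[) h x.
Proof.
move=> st ih; apply: (Rintegral_setB (mu := mu)) => //;
  try exact: measurable_stieltjes_itv.
by apply: subset_itvl; rewrite bnd_simp.
Qed.

Lemma itvcoD (s t : R) : a <= s -> `[a, t[ `\` `[a, s[ = `[s, t[%classic.
Proof.
move=> as_; apply/seteqP; split=> x /=; rewrite !in_itv/=.
  by move=> [/andP[-> ->]] /negP; rewrite andTb -leNgt => ->.
by move=> /andP[sx ->]; rewrite (le_trans as_ sx)/= ltNge sx.
Qed.

Lemma itvcoU (s t : R) : a <= s -> s <= t ->
  `[a, s[ `|` `[s, t[ = `[a, t[%classic.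
Proof.
move=> as_ st; rewrite -(setDUK (_ : `[a, s[ `<=` `[a, t[%classic)) ?itvcoD//.
by apply: subset_itvl; rewrite bnd_simp.
Qed.

Lemma itvco_disjoint (s t : R) : [disjoint `[a, s[%classic & `[s, t[%classic].
Proof.
apply/disj_setPS => x [/=]; rewrite !in_itv/= => /andP[_ xs] /andP[sx _].
by rewrite leNgt xs in sx.
Qed.

Lemma itv_Nyc_setIco (s : R) : s < b -> `]-oo, s] `&` `[a, b[ = `[a, s]%classic.
Proof.
move=> sb; apply/seteqP; split=> t /=; rewrite !in_itv/=.
  by move=> [-> /andP[->]].
by move=> /andP[-> ts]; rewrite ts (le_lt_trans ts).
Qed.

Lemma itv_cy_setIco (t : R) : a <= t -> `[t, +oo[ `&` `[a, b[ = `[t, b[%classic.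
Proof.
move=> at_; apply/seteqP; split=> s /=; rewrite !in_itv/= andbT.
  by move=> [-> /andP[_ ->]].
by move=> /andP[ts ->]; rewrite ts (le_trans at_).
Qed.

Lemma integral_vec_itv_subr f s t : a <= s -> s <= t ->
  (forall i, mu.-integrable setT (EFin \o (fun x => f x 0 i))) ->
  integral_vec g `[a, t[ f = integral_vec g `[a, s[ f + integral_vec g `[s, t[ f.
Proof.
move=> as_ st intf; apply/rowP => i; rewrite !mxE.
by rewrite -(itvcoD t as_) -stieltjes_primitiveB// addrC subrK.
Qed.

Section domination.
Context f (h : R -> R).
Hypothesis intf : forall i, mu.-integrable setT (EFin \o (fun x => f x 0 i)).
Hypothesis inth : mu.-integrable setT (EFin \o h).
Hypothesis fh : forall x, euclidean_norm (f x) <= h x.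

Lemma euclidean_norm_integral_vec (A : set T) : measurable A ->
  euclidean_norm (integral_vec g A f) <= \int[mu]_(x in A) h x.
Proof.
move=> mA; apply: (le_euclidean_norm_Rintegral (mu := mu)) => //.
- by move=> i; exact: integrableS (intf i).
- exact: integrableS inth.
Qed.

(** Integrating over the difference of [[a, t[] and [[a, s[], rather than over [[s, t[], allows [s]
    to lie left of [a], where primitives vanish. *)
Lemma primitive_increment s t i : s <= t ->
  `|integral_vec g `[a, t[ f 0 i - integral_vec g `[a, s[ f 0 i| <= I h t - I h s.
Proof.
move=> st; rewrite !mxE !stieltjes_primitiveB// -?/(I _ _).
have mD : measurable (`[a, t[ `\` `[a, s[ : set T).
  by apply: measurableD; exact: measurable_stieltjes_itv.
have := euclidean_norm_integral_vec mD; apply: le_trans.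
by apply: le_trans (le_coord_euclidean_norm _ i); rewrite mxE.
Qed.

End domination.

Lemma stieltjes_primitive_nd (h : R -> R) : (forall x, 0 <= h x) ->
  mu.-integrable setT (EFin \o h) -> {homo I h : s t / s <= t}.
Proof.
move=> h0 ih s t st; rewrite -subr_ge0 stieltjes_primitiveB//.
exact: Rintegral_ge0.
Qed.

Lemma stieltjes_primitive_bound (h : R -> R) t : (forall x, 0 <= h x) ->
  mu.-integrable setT (EFin \o h) -> 0 <= I h t <= \int[mu]_x h x.
Proof.
move=> h0 ih; rewrite Rintegral_ge0//= -subr_ge0 Rintegral_setB//.
- exact: Rintegral_ge0.
- exact: measurable_stieltjes_itv.
Qed.

Lemma stieltjes_primitive_left_cvg (h : R -> R) t :
  mu.-integrable setT (EFin \o h) ->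
  I h (t - n.+1%:R^-1) @[n --> \oo] --> I h t.
Proof.
move=> ih; apply: cvg_Rintegral_set => //;
  try by move=> *; exact: measurable_stieltjes_itv.
move=> x; have [xt|tx] := ltP x t.
  near=> n; rewrite !mem_setE !in_itv/= xt andbT ltrBrDr -ltrBrDl.
  have -> : n.+1%:R^-1 < t - x; last by rewrite andbT.
  near: n; have := @cvg_harmonic R.
  move=> /cvgrPdist_lt/(_ (t - x)); rewrite subr_gt0 xt => /(_ erefl).
  by apply: filterS => n; rewrite sub0r normrN ger0_norm ?harmonic_ge0.
apply: nearW => n; rewrite !mem_setE !in_itv/= [x < t]ltNge tx/=.
have -> : (x < t - n.+1%:R^-1) = false; last by [].
by apply/negbTE; rewrite -leNgt (le_trans _ tx)// lerBlDr lerDl.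
Unshelve. all: by end_near. Qed.

End primitives.

(** * Euler polygons and the passage to the limit *)

Section euler_scheme.
Context (R : realType) (a b : R) (g : derivator a b) (d : nat).
Local Notation T := (caratheodory_type (wlength (derivator_rc g))^*%mu).
Local Notation mu := (stieltjes g).
Context (F : R -> 'rV[R]_d -> 'rV[R]_d) (u0 : 'rV[R]_d) (h : R -> R) (r : R).
Hypothesis r_ge0 : 0 <= r.
Hypothesis mF : forall x i, measurable_fun setT ((fun t => F t x 0 i) : T -> R).
Hypothesis cF : forall t, continuous (F t).
Hypothesis Fh : forall t x, euclidean_norm x <= r -> euclidean_norm (F t x) <= h t.
Hypothesis inth : mu.-integrable setT (EFin \o h).
Hypothesis u0r : euclidean_norm u0 + \int[mu]_t h t <= r.

Local Notation H := (stieltjes_primitive g h).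

Let h_ge0 t : 0 <= h t.
Proof.
by rewrite (le_trans _ (@Fh t 0 _)) ?euclidean_norm_ge0// euclidean_norm0.
Qed.

Lemma integrable_dominated_field (u : R -> 'rV[R]_d) i :
  measurable_fun setT ((fun t => F t (u t) 0 i) : T -> R) ->
  (forall t, euclidean_norm (u t) <= r) ->
  mu.-integrable setT (EFin \o (fun t => F t (u t) 0 i)).
Proof.
move=> mFu ur; apply: (integrable_bounded_by (mu := mu)) inth => // t _.
exact: le_trans (le_coord_euclidean_norm _ i) (Fh _ (ur t)).
Qed.

(** The mesh is not stopped at [b]: in this section the hypotheses on the field hold at all real
    times. *)
Definition mesh n k : R := a + k%:R / n.+1%:R.

Definition mesh_index n (s : R) : nat := Num.truncn ((s - a) * n.+1%:R).

Fixpoint euler_node n k : 'rV[R]_d :=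
  if k is k'.+1 then
    euler_node n k' +
      integral_vec g `[mesh n k', mesh n k'.+1[ (F ^~ (euler_node n k'))
  else u0.

Definition euler_step n s := euler_node n (mesh_index n s).

Definition euler_solution n t :=
  u0 + integral_vec g `[a, t[ (fun s => F s (euler_step n s)).

Lemma mesh0 n : mesh n 0 = a.
Proof. by rewrite /mesh mul0r addr0. Qed.

Lemma mesh_ge n k : a <= mesh n k.
Proof. by rewrite /mesh lerDl. Qed.

Lemma mesh_le n k : mesh n k <= mesh n k.+1.
Proof. by rewrite /mesh lerD2l ler_pM2r ?invr_gt0// ler_nat. Qed.

Lemma meshS n k : mesh n k.+1 = mesh n k + n.+1%:R^-1.
Proof. by rewrite /mesh -natr1 mulrDl mul1r addrA. Qed.

Lemma mesh_indexP n s : a <= s ->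
  mesh n (mesh_index n s) <= s < mesh n (mesh_index n s).+1.
Proof.
move=> as_; rewrite /mesh -lerBrDl -ltrBlDl ler_pdivrMr// ltr_pdivlMr//.
by apply: truncn_itv; rewrite mulr_ge0// subr_ge0.
Qed.

Lemma mesh_index_eq n k s : mesh n k <= s < mesh n k.+1 -> mesh_index n s = k.
Proof.
move=> ks; apply: truncn_def.
by rewrite -ler_pdivrMr// -ltr_pdivlMr// lerBrDl ltrBlDl.
Qed.

(** The induction carries the sharper bound [|u0| + H (mesh n k)]. It keeps the node in the ball
    where [h] dominates the field, so the next step adds at most an increment of [H], and these
    increments telescope. *)
Lemma euler_node_bound n k : euclidean_norm (euler_node n k) <= r.
Proof.
have Hr j : euclidean_norm u0 + H (mesh n j) <= r.
  apply: le_trans u0r; rewrite lerD2l.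
  by have /andP[] := stieltjes_primitive_bound (mesh n j) h_ge0 inth.
suff nodeH : euclidean_norm (euler_node n k) <= euclidean_norm u0 + H (mesh n k).
  exact: le_trans nodeH (Hr _).
elim: k => [|k IH] /=; first by rewrite stieltjes_primitive_le ?mesh0// addr0.
have nr : euclidean_norm (euler_node n k) <= r := le_trans IH (Hr k).
apply: le_trans (ler_euclidean_normD _ _) _.
have HE : \int[mu]_(x in `[mesh n k, mesh n k.+1[) h x =
    H (mesh n k.+1) - H (mesh n k).
  by rewrite stieltjes_primitiveB ?mesh_le// itvcoD ?mesh_ge.
rewrite -(subrK (H (mesh n k)) (H (mesh n k.+1))) addrCA addrC lerD//.
rewrite -HE; apply: euclidean_norm_integral_vec => //.
- by move=> i; apply: integrable_dominated_field.
- by move=> x; exact: Fh.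
- exact: measurable_stieltjes_itv.
Qed.

(** [mesh_index n] is nondecreasing, hence Borel. *)
Lemma measurable_mesh_index_fiber n k :
  measurable ([set s | mesh_index n s = k] : set T).
Proof.
have mi : measurable_fun [set: R] (fun s => (mesh_index n s)%:R : R).
  apply: nondecreasing_measurable => // s t st.
  by rewrite ler_nat; apply: le_truncn; rewrite ler_pM2r// lerD2r.
apply: borel_stieltjes_measurable.
have -> : [set s | mesh_index n s = k] =
    setT `&` (fun s => (mesh_index n s)%:R : R) @^-1` [set k%:R].
  rewrite setTI; apply/seteqP; split=> s /= => [->//|/eqP].
  by rewrite eqr_nat => /eqP.
exact: mi.
Qed.

(** The countably many fibres of [mesh_index n] cover the line, and on each of them the state is
    constant, so measurability of the field at a fixed state applies. *)
Lemma measurable_euler_field n i :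
  measurable_fun setT ((fun t => F t (euler_step n t) 0 i) : T -> R).
Proof.
have -> : [set: T] = \bigcup_k [set s | mesh_index n s = k].
  by apply/seteqP; split=> // s _; exists (mesh_index n s).
apply: (iffRL (measurable_fun_bigcup _ (measurable_mesh_index_fiber n))) => k.
apply: eq_measurable_fun (measurable_funTS (mF (euler_node n k) i)) => t.
by rewrite inE /euler_step => /= ->.
Qed.

Lemma measurable_euler_step n i :
  measurable_fun setT ((fun t => euler_step n t 0 i) : T -> R).
Proof.
have -> : [set: T] = \bigcup_k [set s | mesh_index n s = k].
  by apply/seteqP; split=> // s _; exists (mesh_index n s).
apply: (iffRL (measurable_fun_bigcup _ (measurable_mesh_index_fiber n))) => k.
apply: eq_measurable_fun (measurable_cst (euler_node n k 0 i)) => t.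
by rewrite inE /euler_step => /= ->.
Qed.

Lemma integrable_euler_field n i :
  mu.-integrable setT (EFin \o (fun t => F t (euler_step n t) 0 i)).
Proof.
apply: integrable_dominated_field; first exact: measurable_euler_field.
by move=> t; exact: euler_node_bound.
Qed.

(** This turns a frozen state into a value of the polygon at a mesh point, so that the gap between
    the two is an increment of the polygon. *)
Lemma euler_solution_node n k : euler_solution n (mesh n k) = euler_node n k.
Proof.
rewrite /euler_solution; elim: k => [|k IH] /=.
  rewrite mesh0; apply/rowP => i; rewrite !mxE.
  by rewrite [X in _ + X]stieltjes_primitive_le ?addr0.
rewrite (@integral_vec_itv_subr _ _ _ _ _ _ (mesh n k)) ?mesh_ge ?mesh_le//; last first.
  exact: integrable_euler_field.
rewrite addrA IH; congr (_ + _); apply/rowP => i; rewrite !mxE.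
apply: eq_Rintegral => s; rewrite inE /= in_itv/= => sk.
by rewrite /euler_step (mesh_index_eq sk).
Qed.

Lemma euler_solution_increment n s t i :
  `|euler_solution n t 0 i - euler_solution n s 0 i| <= `|H t - H s|.
Proof.
wlog st : s t / s <= t.
  by move=> hw; have [/hw//|/ltW/hw] := leP s t; rewrite distrC (distrC (H s)).
rewrite [leRHS]ger0_norm; last by rewrite subr_ge0 stieltjes_primitive_nd.
rewrite ![euler_solution _ _ _ _]mxE opprD addrACA subrr add0r.
apply: primitive_increment => //; first exact: integrable_euler_field.
by move=> x; exact/Fh/euler_node_bound.
Qed.

(** For [t] at or after [a], the last mesh point not after [t] is within [1 / (n + 1)] of [t], and
    [H] is nondecreasing. *)
Lemma euler_step_solution n t i :
  `|euler_step n t 0 i - euler_solution n t 0 i| <= H t - H (t - n.+1%:R^-1).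
Proof.
have nd := stieltjes_primitive_nd h_ge0 inth.
rewrite /euler_step -euler_solution_node.
have [at_|ta] := leP a t; last first.
  (* Left of [a] the index is 0 and every increment of [H] involved is zero. *)
  have -> : mesh_index n t = 0%N.
    apply/truncn0Pn; rewrite -ltNge (le_lt_trans _ ltr01)// nmulr_rle0//.
    by rewrite subr_lt0.
  rewrite mesh0 (le_trans (euler_solution_increment _ _ _ _))//.
  by rewrite !stieltjes_primitive_le ?subrr ?normr0 ?(ltW ta)// lerBlDr ler_wpDr// ltW.
have /andP[lt tl] := mesh_indexP n at_.
rewrite distrC (le_trans (euler_solution_increment _ _ _ _))//.
rewrite [leLHS]ger0_norm ?subr_ge0 ?nd// lerD2l lerN2 nd//.
by rewrite lerBlDr -meshS ltW.
Qed.

Lemma euler_solution_bound n t : euclidean_norm (euler_solution n t) <= r.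
Proof.
apply: le_trans (ler_euclidean_normD _ _) _; apply: le_trans u0r; rewrite lerD2l.
have /andP[_ Hb] := stieltjes_primitive_bound t h_ge0 inth; apply: le_trans Hb.
apply: euclidean_norm_integral_vec => //.
- by move=> i; exact: integrable_euler_field.
- by move=> x; exact/Fh/euler_node_bound.
- exact: measurable_stieltjes_itv.
Qed.

Lemma caratheodory_peano : exists U : R -> 'rV[R]_d,
  [/\ forall i, measurable_fun setT ((fun t => U t 0 i) : T -> R),
      forall t, euclidean_norm (U t) <= r,
      forall i, mu.-integrable setT (EFin \o (fun t => F t (U t) 0 i)) &
      forall t, U t = u0 + integral_vec g `[a, t[ (fun s => F s (U s))].
Proof.
have solr n t i : `|euler_solution n t 0 i| <= r.
  exact: le_trans (le_coord_euclidean_norm _ i) (euler_solution_bound n t).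
have [phi [W [phin WP]]] := equi_dominated_subsequence solr
  (fun t => stieltjes_primitive_bound t h_ge0 inth) euler_solution_increment.
pose U t : 'rV[R]_d := \row_i W t i.
have phioo : phi n @[n --> \oo] --> \oo.
  by apply/cvgnyPge => m; near=> n; apply: leq_trans (phin n);
    near: n; exact: nbhs_infty_ge.
have solU t i : euler_solution (phi n) t 0 i @[n --> \oo] --> U t 0 i.
  by rewrite mxE; exact: WP.
have stepU t i : euler_step (phi n) t 0 i @[n --> \oo] --> U t 0 i.
  have H0 : H t - H (t - (phi n).+1%:R^-1) @[n --> \oo] --> 0.
    rewrite -[X in _ --> X](subrr (H t)); apply: cvgB; first exact: cvg_cst.
    apply: (@cvg_comp _ _ _ phi (fun n => H (t - n.+1%:R^-1)) _ _ _ phioo).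
    exact: stieltjes_primitive_left_cvg.
  have D0 : euler_step (phi n) t 0 i - euler_solution (phi n) t 0 i @[n --> \oo] --> 0.
    apply/cvgr0Pnorm_le => e e0.
    near=> n; apply: le_trans (euler_step_solution _ _ _) _.
    apply: le_trans (ler_norm _) _; near: n.
    by move/cvgr0Pnorm_le : H0; exact.
  have -> : (fun n => euler_step (phi n) t 0 i) =
      (fun n => euler_step (phi n) t 0 i - euler_solution (phi n) t 0 i +
        euler_solution (phi n) t 0 i) by apply/funext => n; rewrite subrK.
  by rewrite -[X in _ --> X]add0r; exact: cvgD.
have Ur t : euclidean_norm (U t) <= r.
  have cU := cvg_euclidean_norm (solU t).
  rewrite -(cvg_lim (@Rhausdorff R) cU); apply: limr_le.
    by apply/cvg_ex; eexists; exact: cU.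
  by apply: nearW => n; exact: euler_solution_bound.
have FU t i : F t (euler_step (phi n) t) 0 i @[n --> \oo] --> F t (U t) 0 i.
  apply: (@cvg_comp _ _ _ (fun n => F t (euler_step (phi n) t)) (fun x => x 0 i)).
    by apply: continuous_cvg; [exact: cF|exact: cvg_row].
  exact: coord_continuous.
exists U; split.
- move=> i; apply: (@measurable_fun_cvg _ T R _ (fun n t => euler_step (phi n) t 0 i)).
    by move=> n; exact: measurable_euler_step.
  by move=> t _; exact: stepU.
- by [].
- move=> i; apply: integrable_dominated_field; last exact: Ur.
  apply: (@measurable_fun_cvg _ T R _ (fun n t => F t (euler_step (phi n) t) 0 i)).
    by move=> n; exact: measurable_euler_field.
  by move=> t _; exact: FU.
- move=> t; apply/rowP => i.
  have mI : measurable (`[a, t[%classic : set T) := measurable_stieltjes_itv g _.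
  have [||||_ cF'] := @dominated_cvg_Rintegral _ T R mu `[a, t[%classic
      (fun n s => F s (euler_step (phi n) s) 0 i) (fun s => F s (U s) 0 i) h mI.
  - by move=> n; exact/measurable_funTS/measurable_euler_field.
  - by move=> s _; exact: FU.
  - exact: integrableS inth.
  - move=> n s _; exact: le_trans (le_coord_euclidean_norm _ i)
      (Fh _ (euler_node_bound _ _)).
  (* The two sides of the integral equation are limits of the same sequence, one by the choice of
     [phi], the other by dominated convergence. *)
  apply: (cvg_unique (@Rhausdorff R) (solU t i)).
  have -> : (u0 + integral_vec g `[a, t[ (fun s => F s (U s))) 0 i =
      u0 0 i + \int[mu]_(s in `[a, t[) F s (U s) 0 i by rewrite mxE [X in _ + X]mxE.
  have -> : (fun n => euler_solution (phi n) t 0 i) = (fun n => u0 0 i +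
      \int[mu]_(s in `[a, t[) F s (euler_step (phi n) s) 0 i).
    by apply/funext => n; rewrite mxE [X in _ + X]mxE.
  by apply: cvgD => //; exact: cvg_cst.
Unshelve. all: by end_near. Qed.

End euler_scheme.

(** * Exchange of the order of integration for real-valued integrals *)

Section Rintegral_swap.
Context d (T : measurableType d) (R : realType).
Context (mu : {sigma_finite_measure set T -> \bar R}).

Lemma EFin_Rintegral (f : T -> R) : mu.-integrable setT (EFin \o f) ->
  (\int[mu]_x (f x)%:E)%E = (\int[mu]_x f x)%:E.
Proof. by move=> intf; rewrite fineK//; exact: integrable_fin_num. Qed.

(** Fubini for the kernel [psi t * f s] cut off to [E], which is dominated by the integrable product
    [|psi t| * |f s|]. Its partial integrals are the integrals over sections of [E]. *)
Lemma Rintegral_swap (E : set (T * T)) (f psi : T -> R) : measurable E ->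
  mu.-integrable setT (EFin \o f) -> mu.-integrable setT (EFin \o psi) ->
  [/\ mu.-integrable setT
        (EFin \o (fun t => psi t * \int[mu]_(s in xsection E t) f s)),
      mu.-integrable setT
        (EFin \o (fun s => f s * \int[mu]_(t in ysection E s) psi t)) &
      \int[mu]_t (psi t * \int[mu]_(s in xsection E t) f s) =
      \int[mu]_s (f s * \int[mu]_(t in ysection E s) psi t)].
Proof.
move=> mE intf intp.
have mf : measurable_fun setT f.
  by apply/measurable_EFinP; exact: measurable_int intf.
have mp : measurable_fun setT psi.
  by apply/measurable_EFinP; exact: measurable_int intp.
pose K (p : T * T) : R := psi p.1 * (f p.2 * \1_E p).
have mK : measurable_fun setT K.
  apply: measurable_funM; first exact: measurableT_comp.
  by apply: measurable_funM; [exact: measurableT_comp|exact: measurable_indic].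
have mx t : measurable (xsection E t) by exact: measurable_xsection.
have my s : measurable (ysection E s) by exact: measurable_ysection.
have K1 t s : K (t, s) = psi t * (f \_ (xsection E t)) s.
  rewrite /K /= indicE /patch mem_xsection.
  by case: (_ \in E); rewrite ?mulr1 ?mulr0.
have K2 t s : K (t, s) = f s * (psi \_ (ysection E s)) t.
  rewrite /K /= indicE /patch mem_ysection.
  by case: (_ \in E); rewrite ?mulr1 ?mulr0// mulrC.
have if_ t : mu.-integrable setT (EFin \o (f \_ (xsection E t))).
  by apply: integrable_patch => //; exact: integrableS intf.
have ip_ s : mu.-integrable setT (EFin \o (psi \_ (ysection E s))).
  by apply: integrable_patch => //; exact: integrableS intp.
have FE t : (\int[mu]_s (K (t, s))%:E)%E =
    (psi t * \int[mu]_(s in xsection E t) f s)%:E.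
  under eq_integral do rewrite K1.
  rewrite EFin_Rintegral ?RintegralZl//; last exact: (integrableZl _ _ (if_ t)).
  by rewrite -Rintegral_mkcond.
have GE s : (\int[mu]_t (K (t, s))%:E)%E =
    (f s * \int[mu]_(t in ysection E s) psi t)%:E.
  under eq_integral do rewrite K2.
  rewrite EFin_Rintegral ?RintegralZl//; last exact: (integrableZl _ _ (ip_ s)).
  by rewrite -Rintegral_mkcond.
have intK : (mu \x mu)%E.-integrable setT (EFin \o K).
  apply/integrable12ltyP; first exact/measurable_EFinP.
  have intaf := integrable_norm intf; have intap := integrable_norm intp.
  apply: (@le_lt_trans _ _
      (\int[mu]_t (`|psi t| * \int[mu]_s `|f s|)%:E)%E); last first.
    rewrite EFin_Rintegral ?ltry//.
    by have := integrableZr measurableT (\int[mu]_s `|f s|) intap.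
  have mKabs : measurable_fun setT (abse \o (EFin \o K)).
    by apply: measurableT_comp => //; exact/measurable_EFinP.
  apply: ge0_le_integral => //.
  - by move=> t _; exact: integral_ge0.
  - by apply: (measurable_fun_fubini_tonelli_F (abse \o (EFin \o K))) => //=.
  - apply/measurable_EFinP; apply: measurable_funM => //.
    exact: measurableT_comp.
  - move=> t _; rewrite -RintegralZl// -EFin_Rintegral; last first.
      by have := integrableZl measurableT (`|psi t|) intaf.
    apply: ge0_le_integral => //.
    + by apply: measurableT_comp => //; apply/measurable_EFinP;
        exact: (measurableT_comp mK).
    + apply/measurable_EFinP; apply: measurable_funM => //.
      exact: measurableT_comp.
    + move=> s _; rewrite lee_fin /K /= !normrM ler_wpM2l// ler_piMr//.
      by rewrite indicE; case: (_ \in E); rewrite ?normr1 ?normr0.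
have iF := integrable_fubini_F intK; have mG := measurable_fubini_G intK.
have FK := Fubini intK.
rewrite /fubini_F /fubini_G /= in iF mG FK.
split.
- by apply: eq_integrable iF => // t _ /=; rewrite FE.
(* On this side Fubini supplies measurability, and integrability comes from the bound by [|f s|]
   times the integral of [|psi|]. *)
- have mG' : measurable_fun setT
      (fun s => f s * \int[mu]_(t in ysection E s) psi t).
    by apply/measurable_EFinP; apply: eq_measurable_fun mG => s _ /=; rewrite GE.
  apply: (integrable_bounded_by measurableT mG')
    (integrableZr measurableT (\int[mu]_t `|psi t|) (integrable_norm intf)).
  move=> s _; rewrite normrM ler_wpM2l// Rintegral_mkcond.
  apply: le_trans (le_normr_Rintegral measurableT (ip_ s)) _.
  apply: (le_Rintegral measurableT (integrable_norm (ip_ s))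
    (integrable_norm intp)) => t _.
  by rewrite /= /patch; case: ifPn => // _; rewrite normr0.
- congr fine; under eq_integral do rewrite -FE.
  by rewrite FK; apply: eq_integral => s _; rewrite GE.
Qed.

(** An abstract [T] has no order, so points are compared through [X]. It is applied to the identity
    from the completed sigma-algebra to the Borel one. *)
Lemma measurable_le_pair (X : T -> R) : measurable_fun setT X ->
  measurable [set p : T * T | X p.1 <= X p.2].
Proof.
move=> mX; rewrite -[X in measurable X]setTI.
apply: (measurable_fun_ler (f := X \o fst) (g := X \o snd) _ _ measurableT
  (Y := [set true])) => //; exact: measurableT_comp.
Qed.

End Rintegral_swap.

(** * Absolute continuity of primitives and integration by parts *)

Section integration_by_parts.
Context (R : realType) (a b : R) (g : derivator a b).
Local Notation T := (caratheodory_type (wlength (derivator_rc g))^*%mu).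
Local Notation mu := (stieltjes g).
Local Notation D := (`[a, b[%classic : set T).
Implicit Types f psi : R -> R.

Let mD : measurable D := measurable_stieltjes_itv g _.

(** Absolute continuity of the integral of [|f|], applied to the union of the intervals: its measure
    is the sum of the increments of [g]. *)
Lemma ACg_primitive f (alpha : R) : mu.-integrable setT (EFin \o f) ->
  ACg g (fun t => alpha + \int[mu]_(s in `[a, t[) f s).
Proof.
move=> intf e e0.
have [delta [delta0 fdelta]] := @integral_normr_continuous _ T R mu f intf e e0.
exists delta => // n s t stab tst sum_lt.
have mI j : measurable (`[s j, t j[%classic : set T) := measurable_stieltjes_itv g _.
pose A : set T := \big[setU/set0]_j `[s j, t j[%classic.
have mA : measurable A by exact: bigsetU_measurable.
have muA : (mu A < delta%:E)%E.
  rewrite [X in (X < _)%E](measure_semi_additive_ord mu mI tst mA).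
  rewrite (eq_bigr (fun j => (g (t j) - g (s j))%:E)) ?sumEFin ?lte_fin// => j _.
  by have [aj [stj tb]] := stab j; apply: stieltjes_itv => //; exact: ltW.
apply: le_lt_trans (fdelta A mA muA).
have -> : \int[mu]_(x in A) `|f x| = \sum_j \int[mu]_(x in `[s j, t j[) `|f x|.
  rewrite /Rintegral integral_bigsetU_EFin//.
  - by rewrite -sum_fine// => j _; apply: integrable_fin_num => //;
      apply: integrableS (integrable_norm intf).
  - exact: index_enum_uniq.
  - by apply: sub_trivIset tst.
  - apply: measurable_funTS; exact: measurable_int (integrable_norm intf).
apply: ler_sum => j _; have [aj [stj tb]] := stab j.
rewrite opprD addrACA subrr add0r -!/(stieltjes_primitive g f _).
rewrite stieltjes_primitiveB ?(ltW stj)// itvcoD//.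
by apply: le_normr_Rintegral => //; exact: integrableS intf.
Qed.

Lemma Rintegral_restrictI (A : set T) f : measurable A ->
  \int[mu]_(x in A) (f \_ D) x = \int[mu]_(x in A `&` D) f x.
Proof. by move=> mA; rewrite Rintegral_mkcondr. Qed.

(* Fubini's theorem on [{(t, s) | t <= s}]; the closed interval [[a, s]] in the
   second factor is what the posterior trace of the primitive of [psi] is. *)
Lemma stieltjes_integration_by_parts f psi (alpha beta : R) :
  stieltjes_L1 g f -> stieltjes_L1 g psi ->
  [/\ stieltjes_L1 g (fun t => (alpha + \int[mu]_(s in `[a, t[) f s) * psi t),
      stieltjes_L1 g (fun s => f s * (beta + \int[mu]_(t in `[a, s]) psi t)) &
      \int[mu]_(t in `[a, b[) ((alpha + \int[mu]_(s in `[a, t[) f s) * psi t) +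
      \int[mu]_(s in `[a, b[) (f s * (beta + \int[mu]_(t in `[a, s]) psi t)) =
      (alpha + \int[mu]_(s in `[a, b[) f s) *
        (beta + \int[mu]_(t in `[a, b[) psi t) - alpha * beta].
Proof.
have alg1 (x y z w : R) : (x + y) * z - z * (y - w) = (x + w) * z by ring.
have alg2 (x y z : R) : x * y + y * z = y * (x + z) by ring.
have alg3 (x y z w v : R) :
  (x + y) * z - v + (w * y + v) = (x + y) * (w + z) - x * w by ring.
rewrite /stieltjes_L1 => intf intp.
have intf' : mu.-integrable setT (EFin \o (f \_ D)).
  exact: (@integrable_patch _ T).
have intp' : mu.-integrable setT (EFin \o (psi \_ D)).
  exact: (@integrable_patch _ T).
pose E : set (T * T) := [set p | (p.1 : R) <= p.2].
have mE : measurable E := measurable_le_pair (@measurable_stieltjes_id _ _ _ g).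
have xE t : xsection E t = `[(t : R), +oo[%classic.
  by apply/seteqP; split=> s; rewrite xsectionE /= in_itv/= andbT.
have yE s : ysection E s = `]-oo, (s : R)]%classic.
  by apply/seteqP; split=> t; rewrite ysectionE /= in_itv/=.
have [int1 int2 eq12] := @Rintegral_swap _ T R
  (completed_lebesgue_stieltjes_measure (derivator_rc g)) E _ _ mE intf' intp'.
have psiE s : D s -> \int[mu]_(t in ysection E s) (psi \_ D) t =
    \int[mu]_(t in `[a, s]) psi t.
  move=> /=; rewrite in_itv/= => /andP[_ sb].
  have mI := measurable_stieltjes_itv g `]-oo, (s : R)].
  by rewrite yE (Rintegral_restrictI _ mI) itv_Nyc_setIco.
have fE t : D t -> \int[mu]_(s in xsection E t) (f \_ D) s =
    \int[mu]_(s in `[a, b[) f s - \int[mu]_(s in `[a, t[) f s.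
  move=> /=; rewrite in_itv/= => /andP[at_ tb].
  have mI := measurable_stieltjes_itv g `[(t : R), +oo[.
  have mat := measurable_stieltjes_itv g `[a, t[.
  have mtb := measurable_stieltjes_itv g `[t, b[.
  rewrite xE (Rintegral_restrictI _ mI) (itv_cy_setIco _ at_).
  have atb := itvcoU at_ (ltW tb).
  have intab : mu.-integrable (`[a, t[ `|` `[t, b[) (EFin \o f) by rewrite atb.
  rewrite -atb (Rintegral_setU mat mtb intab (itvco_disjoint _ _ _)).
  by rewrite [RHS]addrAC subrr add0r.
pose P1 s := (f \_ D) s * \int[mu]_(t in ysection E s) (psi \_ D) t.
pose P2 t := (psi \_ D) t * \int[mu]_(s in xsection E t) (f \_ D) s.
have P1E s : D s -> P1 s = f s * \int[mu]_(t in `[a, s]) psi t.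
  by move=> Ds; rewrite /P1 patchE mem_set// psiE.
have P2E t : D t -> P2 t =
    psi t * (\int[mu]_(s in `[a, b[) f s - \int[mu]_(s in `[a, t[) f s).
  by move=> Dt; rewrite /P2 patchE mem_set// fE.
have P1D : \int[mu]_(s in D) P1 s = \int[mu]_s P1 s.
  rewrite Rintegral_mkcond; apply: eq_Rintegral => s _.
  by rewrite patchE; case: ifPn => // sD; rewrite /P1 patchE (negbTE sD) mul0r.
have P2D : \int[mu]_(s in D) P2 s = \int[mu]_s P2 s.
  rewrite Rintegral_mkcond; apply: eq_Rintegral => s _.
  by rewrite patchE; case: ifPn => // sD; rewrite /P2 patchE (negbTE sD) mul0r.
have intP1 : mu.-integrable D (EFin \o P1) by exact: integrableS int2.
have intP2 : mu.-integrable D (EFin \o P2) by exact: integrableS int1.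
set If := \int[mu]_(s in `[a, b[) f s; set Ip := \int[mu]_(s in `[a, b[) psi s.
have intA : mu.-integrable D (EFin \o (fun t => (alpha + If) * psi t)).
  by have := integrableZl mD (alpha + If) intp.
have intB : mu.-integrable D (EFin \o (fun t => beta * f t)).
  by have := integrableZl mD beta intf.
(* The integral of [f] over [[a, t[] is the total [If] minus that over [[t, b[]. The two integrands
   become constant multiples of [psi] and [f], corrected by [- P2] and [+ P1], whose integrals
   cancel by the swap. *)
have E1 : {in D, (fun t => (alpha + If) * psi t - P2 t) =1
    (fun t => (alpha + \int[mu]_(s in `[a, t[) f s) * psi t)}.
  by move=> t; rewrite inE => Dt; rewrite P2E// alg1.
have E2 : {in D, (fun t => beta * f t + P1 t) =1
    (fun s => f s * (beta + \int[mu]_(t in `[a, s]) psi t))}.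
  by move=> t; rewrite inE => Dt; rewrite P1E// alg2.
split.
- apply: eq_integrable (integrableB mD intA intP2) => // t tD.
  by rewrite /= -EFinB; congr EFin; exact: E1.
- apply: eq_integrable (integrableD mD intB intP1) => // t tD.
  by rewrite /= -EFinD; congr EFin; exact: E2.
- rewrite -(eq_Rintegral _ E1) -(eq_Rintegral _ E2) (RintegralB mD intA intP2).
  rewrite (RintegralD mD intB intP1) (RintegralZl _ mD intp) (RintegralZl _ mD intf).
  rewrite P1D P2D -/If -/Ip.
  have -> : \int[mu]_s P2 s = \int[mu]_s P1 s by exact: eq12.
  exact: alg3.
Qed.

End integration_by_parts.

(** * Posterior traces of test functions and the weak formulation *)

Section weak_solution.
Context (R : realType) (a b : R) (g : derivator a b).
Local Notation T := (caratheodory_type (wlength (derivator_rc g))^*%mu).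
Local Notation mu := (stieltjes g).
Local Notation D := (`[a, b[%classic : set T).

Let mD : measurable D := measurable_stieltjes_itv g _.

(** The total mass [g b - g a] is finite, so constants are integrable. *)
Lemma stieltjes_L1_ae_bounded (psi : R -> R) (M : R) :
  stieltjes_measurable g psi -> ae_on g (fun t => `|psi t| <= M) ->
  stieltjes_L1 g psi.
Proof.
move=> mpsi psiM; apply/integrableP; split; first exact/measurable_EFinP.
(* The sign of [M] is not known, and the comparison of integrals asks for a nonnegative bound. *)
apply: (@le_lt_trans _ _ (\int[mu]_(t in D) (cst `|M|%:E t))%E).
  apply: (ae_ge0_le_integral mD).
  - by move=> t _; exact: abse_ge0.
  - by apply: measurableT_comp => //; exact/measurable_EFinP.
  - by move=> t _; rewrite /= lee_fin.
  - exact: measurable_cst.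
  - apply: (ae_onS (P := fun t => `|psi t| <= M)) psiM => t _ psiM.
    by rewrite /= lee_fin (le_trans psiM)// ler_norm.
rewrite (integral_cst mu mD) [X in (_ * X)%E](_ : _ = (g b - g a)%:E).
  by rewrite -EFinM ltry.
by apply: stieltjes_itv => //; exact: ltW (derivator_lt g).
Qed.

(** The intervals [[a, s[] decrease to the closed interval [[a, t]] as [s] decreases to [t], so the
    limit picks up the atom at [t]. *)
Lemma primitive_right_cvg (psi phi : R -> R) (beta t : R) : stieltjes_L1 g psi ->
  (forall s, s \in `[a, b] -> phi s = beta + \int[mu]_(x in `[a, s[) psi x) ->
  t \in `[a, b[ ->
  phi s @[s --> t^'+] --> beta + \int[mu]_(x in `[a, t]) psi x.
Proof.
move=> intp phiE; rewrite in_itv/= => /andP[at_ tb].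
have intp' : mu.-integrable setT (EFin \o (psi \_ D)).
  exact: (@integrable_patch _ T).
have sub_psi (A : set R) : A `<=` `[a, b[%classic ->
    \int[mu]_(x in A) psi x = \int[mu]_(x in A) (psi \_ D) x.
  by move=> AD; apply: eq_Rintegral => x xA; rewrite patchE mem_set//;
    apply: AD; exact: set_mem.
have -> : \int[mu]_(x in `[a, t]) psi x = \int[mu]_(x in `[a, t]) (psi \_ D) x.
  by apply: sub_psi; apply: subset_itvl; rewrite bnd_simp.
have cvgI : (beta + \int[mu]_(x in `[a, s[) (psi \_ D) x) @[s --> t^'+] -->
    beta + \int[mu]_(x in `[a, t]) (psi \_ D) x.
  apply: cvgD; first exact: cvg_cst.
  apply/cvg_at_rightP => u [tu ut]; apply: cvg_Rintegral_set => //.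
  - by move=> n; exact: measurable_stieltjes_itv.
  - exact: measurable_stieltjes_itv.
  move=> x; have [xt|tx] := leP x t.
    by apply: nearW => n; rewrite !mem_setE !in_itv/= xt (le_lt_trans xt (tu n)).
  near=> n; rewrite !mem_setE !in_itv/= [x <= t]leNgt tx/=.
  have -> : (x < u n) = false; last by [].
  apply/negbTE; rewrite -leNgt ltW//; near: n.
  exact: (cvgr_lt t).
apply: cvg_trans cvgI; apply: near_eq_cvg; near=> s.
have ts : t < s by near: s; exact: nbhs_right_gt.
have sb : s <= b by near: s; exact: nbhs_right_le.
rewrite -sub_psi ?phiE ?in_itv/= ?sb ?(le_trans at_ (ltW ts))//.
by apply: subset_itvl; rewrite bnd_simp.
Unshelve. all: by end_near. Qed.

Lemma primitive_no_jump (psi : R -> R) t : stieltjes_L1 g psi ->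
  t \in `[a, b[ -> t \notin jump_points g ->
  \int[mu]_(x in `[a, t[) psi x = \int[mu]_(x in `[a, t]) psi x.
Proof.
move=> intp tab tJ; have := tab; rewrite in_itv/= => /andP[at_ tb].
have tE : `[a, t[%classic `|` [set t] = `[a, t]%classic.
  by rewrite setUitv1// bnd_simp.
have m1 : measurable ([set t] : set T).
  by rewrite -[X in measurable X]set_itv1; exact: measurable_stieltjes_itv.
have mat := measurable_stieltjes_itv g `[a, t[.
have int_at : mu.-integrable (`[a, t] : set T) (EFin \o psi).
  apply: integrableS intp => //; first exact: measurable_stieltjes_itv.
  by apply: subset_itvl; rewrite bnd_simp.
rewrite -tE (Rintegral_setU mat m1) ?tE//; last first.
  apply/disj_setPS => x [/= + xt]; rewrite xt in_itv/= ltxx andbF.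
  by [].
rewrite [X in _ + X](_ : _ = 0) ?addr0//.
rewrite /Rintegral (null_set_integral m1 _ (stieltjes_set1_eq0 tab tJ))//.
apply: measurable_funS (measurable_int mu int_at) => //.
  exact: measurable_stieltjes_itv.
by move=> _ ->; rewrite /= in_itv/= at_ lexx.
Qed.

(** At a jump the right limit adds the atom; elsewhere the point is null, so closing the interval
    changes nothing. One formula thus serves both cases of the trace. *)
Lemma posterior_trace_primitive (phi psi : R -> R[i]) (c : R[i]) t :
  stieltjes_L1 g (fun t => complex.Re (psi t)) ->
  stieltjes_L1 g (fun t => complex.Im (psi t)) ->
  (forall s, s \in `[a, b] -> phi s = c + integral_cplx g `[a, s[ psi) ->
  t \in `[a, b[ ->
  posterior_trace g phi t = c + integral_cplx g `[a, t] psi.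
Proof.
move=> intr inti phiE tab.
have Rphi s : s \in `[a, b] -> complex.Re (phi s) =
    complex.Re c + \int[mu]_(x in `[a, s[) complex.Re (psi x).
  by move=> sab; rewrite phiE//; case: (c).
have Iphi s : s \in `[a, b] -> complex.Im (phi s) =
    complex.Im c + \int[mu]_(x in `[a, s[) complex.Im (psi x).
  by move=> sab; rewrite phiE//; case: (c).
have -> : c + integral_cplx g `[a, t] psi =
    Complex (complex.Re c + \int[mu]_(x in `[a, t]) complex.Re (psi x))
      (complex.Im c + \int[mu]_(x in `[a, t]) complex.Im (psi x)).
  by case: c phiE Rphi Iphi.
rewrite /posterior_trace; case: ifPn => tJ.
  rewrite /right_limit.
  rewrite (cvg_lim _ (primitive_right_cvg intr Rphi tab))//.
  by rewrite (cvg_lim _ (primitive_right_cvg inti Iphi tab)).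
have tab' : t \in `[a, b] by move: tab; rewrite !in_itv/= => /andP[-> /ltW->].
rewrite -!primitive_no_jump// -Rphi// -Iphi//.
by case: (phi t).
Qed.

(** Since [w] and [f] are real, the identity splits into real and imaginary parts. Each is an
    integration by parts whose constant [beta] is a part of [c], and [c] is [phi a] because the
    integral over [[a, a[] is empty. *)
Lemma weak_formulation (K : scalar_field) (w f : R -> R) (alpha : R)
    (phi psi : R -> R[i]) :
  stieltjes_L1 g f ->
  (forall t, t \in `[a, b] -> w t = alpha + \int[mu]_(s in `[a, t[) f s) ->
  test_function g K phi psi ->
  integral_cplx g `[a, b[ (fun t => (w t)%:C%C * psi t) +
  integral_cplx g `[a, b[ (fun t => (f t)%:C%C * posterior_trace g phi t) =
  (w b)%:C%C * phi b - alpha%:C%C * phi a.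
Proof.
move=> intf wE [[_ mr mi [M psiM]] [c _ phiE]].
have RM (x : R) (z : R[i]) :
    complex.Re (x%:C%C * z) = x * complex.Re z /\
    complex.Im (x%:C%C * z) = x * complex.Im z.
  by case: z => zr zi /=; rewrite !mul0r subr0 addr0.
have intr : stieltjes_L1 g (fun t => complex.Re (psi t)).
  apply: (stieltjes_L1_ae_bounded (M := M)) => //.
  apply: ae_onS psiM => t _ psiM.
  by have := le_trans (normc_ge_Re _) psiM; rewrite lecR.
have inti : stieltjes_L1 g (fun t => complex.Im (psi t)).
  apply: (stieltjes_L1_ae_bounded (M := M)) => //.
  apply: ae_onS psiM => t _; rewrite normc_def lecR; apply: le_trans.
  by rewrite -sqrtr_sqr ler_sqrt ?lerDr ?addr_ge0 ?sqr_ge0.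
have aab : a \in `[a, b] by rewrite in_itv/= lexx ltW// (derivator_lt g).
have bab : b \in `[a, b] by rewrite in_itv/= lexx ltW// (derivator_lt g).
have [_ _ ibpr] := stieltjes_integration_by_parts alpha (complex.Re c) intf intr.
have [_ _ ibpi] := stieltjes_integration_by_parts alpha (complex.Im c) intf inti.
have Dab t : t \in D -> t \in `[a, b].
  by rewrite inE/= !in_itv/= => /andP[-> /ltW ->].
have wpsi : integral_cplx g `[a, b[ (fun t => (w t)%:C%C * psi t) = Complex
    (\int[mu]_(t in `[a, b[)
      ((alpha + \int[mu]_(s in `[a, t[) f s) * complex.Re (psi t)))
    (\int[mu]_(t in `[a, b[)
      ((alpha + \int[mu]_(s in `[a, t[) f s) * complex.Im (psi t))).
  by rewrite /integral_cplx; congr Complex; apply: eq_Rintegral => t tD;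
    have [ReE ImE] := RM (w t) (psi t); rewrite ?ReE ?ImE wE// Dab.
have ftrace : integral_cplx g `[a, b[
      (fun t => (f t)%:C%C * posterior_trace g phi t) = Complex
    (\int[mu]_(s in `[a, b[)
      (f s * (complex.Re c + \int[mu]_(t in `[a, s]) complex.Re (psi t))))
    (\int[mu]_(s in `[a, b[)
      (f s * (complex.Im c + \int[mu]_(t in `[a, s]) complex.Im (psi t)))).
  rewrite /integral_cplx; congr Complex; apply: eq_Rintegral => t tD;
    have [ReE ImE] := RM (f t) (posterior_trace g phi t); rewrite ?ReE ?ImE;
    rewrite (posterior_trace_primitive intr inti phiE) ?(set_mem tD)//;
    by case: (c).
rewrite -(wE b bab) in ibpr ibpi.
have phia : phi a = c.
  rewrite phiE// /integral_cplx set_itv_ge ?bnd_simp ?ltxx// !Rintegral_set0.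
  by case: (c) => cr ci; rewrite /= /GRing.add /= !addr0.
have [Reb Imb] := RM (w b) (phi b); have [Rea Ima] := RM alpha (phi a).
have subE (y z : R[i]) : y - z =
    Complex (complex.Re y - complex.Re z) (complex.Im y - complex.Im z).
  by case: y => yr yi; case: z.
rewrite wpsi ftrace subE Reb Imb Rea Ima phia.
have addE (x y x' y' : R) :
  Complex x y + Complex x' y' = Complex (x + x') (y + y') by [].
rewrite addE ibpr ibpi; congr Complex; congr (_ * _ - _).
  by rewrite (phiE b bab); case: (c).
by rewrite (phiE b bab); case: (c).
Qed.

End weak_solution.

(** * Almost-everywhere hypotheses and the existence theorem *)

Section existence.
Context (R : realType) (a b : R) (g : derivator a b) (d : nat).
Local Notation T := (caratheodory_type (wlength (derivator_rc g))^*%mu).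
Local Notation mu := (stieltjes g).
Local Notation D := (`[a, b[%classic : set T).

Let mD : measurable D := measurable_stieltjes_itv g _.

(* The hypotheses hold everywhere for the field set to [0] on a null set and
   outside [[a, b[], to which the Euler scheme applies. *)
Lemma integral_equation_solution (F : R -> 'rV[R]_d -> 'rV[R]_d) (u0 : 'rV[R]_d)
    (r : R) (h : R -> R) :
  (forall x, stieltjes_measurable_vec g (fun t => F t x)) ->
  ae_on g (fun t => continuous (F t)) ->
  0 <= r -> stieltjes_L1 g h ->
  ae_on g (fun t => forall x,
    euclidean_norm x <= r -> euclidean_norm (F t x) <= h t) ->
  euclidean_norm u0 + stieltjes_L1norm g h <= r ->
  exists U : R -> 'rV[R]_d,
    [/\ stieltjes_measurable_vec g U, ACg_vec g U, integral_solution g F u0 U &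
        forall t, euclidean_norm (U t) <= r].
Proof.
move=> mF /ae_onP[N1 [mN1 N10 cF]] r0 inth /ae_onP[N2 [mN2 N20 Fh]] u0r.
pose G : set T := D `\` (N1 `|` N2).
have mG : measurable G by apply: measurableD => //; exact: measurableU.
have GD : G `<=` D by move=> t [].
pose F' t x : 'rV[R]_d := if t \in G then F t x else 0.
have mF' x i : measurable_fun setT ((fun t => F' t x 0 i) : T -> R).
  have -> : ((fun t => F' t x 0 i) : T -> R) = (fun t => F t x 0 i) \_ G.
    by apply/funext => t; rewrite /F' patchE; case: ifP => // _; rewrite mxE.
  apply/(measurable_restrict _ mG measurableT); rewrite setTI.
  exact: measurable_funS (mF x i).
have cF' t : continuous (F' t).
  have [tG|tG] := boolP (t \in G).
    have -> : F' t = F t by apply/funext => x; rewrite /F' tG.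
    by case/set_mem: tG => tD /not_orP[tN1 _]; exact: cF.
  have -> : F' t = cst 0 by apply/funext => x; rewrite /F' (negbTE tG).
  exact: cst_continuous.
(* [stieltjes_L1norm] integrates [|h|], so [|h|] cut off to [G] is the dominating function; the
   cut-off can only lower the integral. *)
have Fh' t x : euclidean_norm x <= r ->
    euclidean_norm (F' t x) <= ((Num.norm \o h) \_ G) t.
  move=> xr; rewrite /F' patchE; case: ifPn => [/set_mem[tD /not_orP[_ tN2]]|_].
    by rewrite (le_trans (Fh _ tD tN2 _ xr))//= ler_norm.
  by rewrite euclidean_norm0.
have inth' : mu.-integrable setT (EFin \o ((Num.norm \o h) \_ G)).
  apply: (@integrable_patch _ T) => //.
  by apply: integrableS (integrable_norm inth).
have u0r' : euclidean_norm u0 + \int[mu]_t ((Num.norm \o h) \_ G) t <= r.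
  apply: le_trans u0r; rewrite lerD2l /stieltjes_L1norm [leRHS]Rintegral_mkcond.
  apply: (le_Rintegral measurableT inth').
    by apply: (@integrable_patch _ T) => //; exact: integrable_norm.
  move=> t _; rewrite !patchE; case: ifPn => [/set_mem/GD tD|_].
    by rewrite mem_set.
  by case: ifP => // _; exact: normr_ge0.
have [U [mU Ur intU UE]] := caratheodory_peano r0 mF' cF' Fh' inth' u0r'.
(* The two fields agree on [[a, b[] off the null set [N1 U N2], whatever the state, so integrability
   and the integrals pass from [F'] back to [F]. *)
have FF' i : ae_on g (fun t => F' t (U t) 0 i = F t (U t) 0 i).
  apply/ae_onP; exists (N1 `|` N2); split; first exact: measurableU.
    by apply: null_set_setU.
  by move=> t tD tN; rewrite /F' mem_set.
have L1F i := integrable_ae_eq (@stieltjes_complete _ _ _ g) mD (FF' i)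
  (integrableS measurableT mD (@subsetT _ _) (intU i)).
exists U; split=> //.
- by move=> i; exact: measurable_funTS.
- move=> i; have := ACg_primitive (u0 0 i) (intU i).
  congr (ACg g _); apply/funext => t.
  by rewrite (UE t) mxE [X in _ = _ + X]mxE.
- split=> [i|t]; first by have [] := L1F i.
  rewrite in_itv/= => /andP[at_ tb]; rewrite UE; congr (_ + _).
  apply/rowP => i; rewrite !mxE; have [_] := L1F i; apply.
    exact: measurable_stieltjes_itv.
  by apply: subset_itvl; rewrite bnd_simp.
Qed.

End existence.

Theorem theorem6p9 (R : realType) (K : scalar_field) (a b : R)
    (g : derivator a b) (d : nat)
    (F : R -> 'rV[R]_d -> 'rV[R]_d) (u0 : 'rV[R]_d)
    (Mg_gt0 : 0 < g b - g a)
    (F_measurable : forall x : 'rV[R]_d,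
      stieltjes_measurable_vec g (fun t => F t x))
    (F_continuous : ae_on g (fun t => continuous (F t)))
    (r : R) (hr : R -> R)
    (r_gt0 : 0 < r)
    (hr_L1 : stieltjes_L1 g hr)
    (hr_ge0 : ae_on g (fun t => 0 <= hr t))
    (F_bound : ae_on g (fun t => forall x : 'rV[R]_d,
      euclidean_norm x <= r -> euclidean_norm (F t x) <= hr t))
    (u0_bound : euclidean_norm u0 + stieltjes_L1norm g hr <= r) :
  (exists U : R -> 'rV[R]_d,
    [/\ ACg_vec g U,
        integral_solution g F u0 U &
        forall t, t \in `[a, b] -> euclidean_norm (U t) <= r]) /\
  (exists (u : R -> 'rV[R]_d) (ub : 'rV[R]_d),
    global_weak_solution g K F u u0 ub).
Proof.
have [U [mU ACU [intF solU] Ur]] := integral_equation_solution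
  F_measurable F_continuous (ltW r_gt0) hr_L1 F_bound u0_bound.
split; first by exists U.
exists U, (U b); split=> //.
(* [U] is integrable because it is measurable, stays in the ball of radius [r], and the measure of
   [[a, b[] is finite. *)
- move=> i; apply: (stieltjes_L1_ae_bounded (M := r)) => //.
  apply/ae_onP; exists set0; split=> // t _ _.
  exact: le_trans (le_coord_euclidean_norm _ i) (Ur t).
- move=> phi psi test i.
  apply: (weak_formulation (intF i) _ test) => t tab.
  by rewrite (solU t tab) mxE [X in _ + X]mxE.
Qed.
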